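(* Let $R\subseteq\Lambda^\infty\times\Lambda^\infty$ be such that $\to_R$ is appendable. Then for all $s,t\in\Lambda^\infty$: $s\to^\infty_R t$ holds if and only if there exists a strongly convergent $R$-reduction sequence from $s$ to $t$. Moreover, if $s\to^\infty_R t$ then such a sequence may be chosen to have length at most $\omega$.
   Context: Infinitary lambda terms $\Lambda^\infty$ are the finite and infinite terms generated coinductively by $\Lambda^\infty ::= C \mid V \mid \Lambda^\infty\Lambda^\infty \mid \lambda V.\Lambda^\infty$, where $V$ is an infinite set of variables and $C$ a set of constants disjoint from $V$ containing a distinguished constant $\bot$; atoms are variables or constants; terms are taken modulo renaming of bound variables. $\to_R$ is the compatible closure of $R$: the least relation containing $R$ and closed under $s\to_R s'\Rightarrow st\to_R s't,\ ts\to_R ts',\ \lambda x.s\to_R\lambda x.s'$. For a relation $\to$, $\to^*$ is its reflexive-transitive closure and its infinitary closure $\to^\infty$ is defined coinductively: $s\to^\infty a$ if $s\to^* a$ ($a$ an atom); $s\to^\infty t_1't_2'$ if $s\to^* t_1t_2$ and $t_i\to^\infty t_i'$; $s\to^\infty\lambda x.r'$ if $s\to^*\lambda x.r$ and $r\to^\infty r'$. A relation $\to$ is appendable if $t_1\to^\infty t_2\to t_3$ implies $t_1\to^\infty t_3$. Define the metric $d(t,s)=\inf\{2^{-n}\mid t^{\upharpoonright n}\equiv s^{\upharpoonright n}\}$, where $r^{\upharpoonright n}$ replaces all subterms of $r$ at depth $n$ by $\bot$. For an ordinal $\zeta$, a strongly convergent $R$-reduction sequence of length $\zeta$ from $f(0)$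 to $f(\zeta)$ is a map $f:\{\gamma\le\zeta\}\to\Lambda^\infty$ with steps $\sigma_\gamma: f(\gamma)\to_R f(\gamma+1)$ for $\gamma<\zeta$ such that for every limit ordinal $\delta\le\zeta$: (1) $f(\delta)$ is the limit of $(f(\gamma))_{\gamma<\delta}$ in the metric topology, and (2) for every $d\in\mathbb{N}$ there is $\gamma<\delta$ such that for all $\gamma'$ with $\gamma\le\gamma'<\delta$ the redex contracted in $\sigma_{\gamma'}$ occurs at depth greater than $d$.
   Formalization: Terms are in de Bruijn form, so λx.s→λx.s' acts on one canonical body of each abstraction; this agrees with the named closure when R is closed under renaming of variables, while for other R the literal named statement can fail, e.g. R={(c x,d x),(e y,d y)}. *)

(* Defs.v *)
From Stdlib Require Import Reals Relations Morphisms RelationClasses.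
From Coquelicot Require Import Coquelicot.

(** Infinitary lambda terms modulo renaming of bound variables, in de Bruijn
    form: below [k] binders, [Var i] is bound if [i < k] and otherwise denotes
    the free variable number [i - k].  The abstraction of the variable number 0
    in [r] is [Lam r].  [C] is the set of constants.  (With named binders and a
    relation on terms that is not closed under renaming of variables, the name
    chosen for a binder could change at each of infinitely many steps below it;
    here every abstraction has one canonical body.) *)
CoInductive term (C : Type) : Type :=
| Var : nat -> term C
| Cst : C -> term C
| App : term C -> term C -> term C
| Lam : term C -> term C.
Arguments Var {C}.
Arguments Cst {C}.
Arguments App {C}.
Arguments Lam {C}.

(** Equality of infinite terms is bisimilarity, since Leibniz equality is too
    fine on a coinductive type.  All relations below are defined up to it. *)
CoInductive bisim {C : Type} : term C -> term C -> Prop :=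
| bisim_var i : bisim (Var i) (Var i)
| bisim_cst c : bisim (Cst c) (Cst c)
| bisim_app s s' t t' :
    bisim s s' -> bisim t t' -> bisim (App s t) (App s' t')
| bisim_lam s s' : bisim s s' -> bisim (Lam s) (Lam s').

Declare Scope term_scope.
Delimit Scope term_scope with term.
Infix "≡" := bisim (at level 70, no associativity) : term_scope.
Local Open Scope term_scope.

Definition atom {C : Type} (t : term C) : Prop :=
  match t with Var _ | Cst _ => True | _ => False end.

Inductive compat {C : Type} (R : relation (term C)) : relation (term C) :=
| compat_base s t : R s t -> compat R s t
| compat_appl s s' t t' :
    compat R s s' -> t ≡ t' -> compat R (App s t) (App s' t')
| compat_appr s s' t t' :
    s ≡ s' -> compat R t t' -> compat R (App s t) (App s' t')
| compat_lam s s' : compat R s s' -> compat R (Lam s) (Lam s').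

(** Same rules as [compat], recording the depth of the contracted redex. *)
Inductive compat_at {C : Type} (R : relation (term C)) :
  nat -> relation (term C) :=
| compat_at_base s t : R s t -> compat_at R 0 s t
| compat_at_appl n s s' t t' :
    compat_at R n s s' -> t ≡ t' -> compat_at R (S n) (App s t) (App s' t')
| compat_at_appr n s s' t t' :
    s ≡ s' -> compat_at R n t t' -> compat_at R (S n) (App s t) (App s' t')
| compat_at_lam n s s' :
    compat_at R n s s' -> compat_at R (S n) (Lam s) (Lam s').

Inductive star {C : Type} (step : relation (term C)) : relation (term C) :=
| star_refl s t : s ≡ t -> star step s t
| star_step s u t : step s u -> star step u t -> star step s t.

CoInductive infcl {C : Type} (step : relation (term C)) : relation (term C) :=
| infcl_atom s a : atom a -> star step s a -> infcl step s a
| infcl_app s t1 t2 t1' t2' :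
    star step s (App t1 t2) -> infcl step t1 t1' -> infcl step t2 t2' ->
    infcl step s (App t1' t2')
| infcl_lam s r r' :
    star step s (Lam r) -> infcl step r r' -> infcl step s (Lam r').

Definition appendable {C : Type} (step : relation (term C)) : Prop :=
  forall t1 t2 t3, infcl step t1 t2 -> step t2 t3 -> infcl step t1 t3.

Fixpoint trunc {C : Type} (bot : C) (n : nat) (t : term C) : term C :=
  match n with
  | 0 => Cst bot
  | S m =>
      match t with
      | Var i => Var i
      | Cst c => Cst c
      | App u v => App (trunc bot m u) (trunc bot m v)
      | Lam u => Lam (trunc bot m u)
      end
  end.

(** The set is nonempty ([n = 0]) and bounded below by 0, so that the infimum
    in [Rbar] is finite. *)
Definition term_dist {C : Type} (bot : C) (t s : term C) : R :=
  real (Glb_Rbar (fun x : R =>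
    exists n : nat, trunc bot n t ≡ trunc bot n s /\ x = (/ 2 ^ n)%R)).

(** Ordinals are presented as well-ordered types; the elements of [ζ] are the
    ordinals smaller than [ζ]. *)
Record ordinal : Type := Ordinal {
  ord_car :> Type;
  ord_lt : ord_car -> ord_car -> Prop;
  ord_trans : forall x y z, ord_lt x y -> ord_lt y z -> ord_lt x z;
  ord_total : forall x y, ord_lt x y \/ x = y \/ ord_lt y x;
  ord_wf : well_founded ord_lt
}.
Arguments ord_lt {_}.

Definition omega : ordinal :=
  Ordinal nat lt Nat.lt_trans Nat.lt_trichotomy Wf_nat.lt_wf.

(** [α <= β] iff [α] is isomorphic to an initial segment of [β]. *)
Definition ord_le (α β : ordinal) : Prop :=
  exists h : α -> β,
    (forall x y, ord_lt x y -> ord_lt (h x) (h y)) /\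
    (forall x z, ord_lt z (h x) -> exists y, z = h y).

(** The ordinals [γ <= ζ]: [None] is [ζ] itself. *)
Definition upto (ζ : ordinal) : Type := option ζ.

Definition upto_lt {ζ : ordinal} (x y : upto ζ) : Prop :=
  match x, y with
  | Some a, Some b => ord_lt a b
  | Some _, None => True
  | None, _ => False
  end.

Definition upto_le {ζ : ordinal} (x y : upto ζ) : Prop := upto_lt x y \/ x = y.

Definition is_zero {ζ : ordinal} (x : upto ζ) : Prop := forall y, ~ upto_lt y x.

Definition is_succ {ζ : ordinal} (x y : upto ζ) : Prop :=
  upto_lt x y /\ forall z, ~ (upto_lt x z /\ upto_lt z y).

Definition is_limit {ζ : ordinal} (x : upto ζ) : Prop :=
  ~ is_zero x /\ ~ (exists y, is_succ y x).

(** [seq_depth γ] is the depth of the redex contracted in the step from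
    [seq_term γ] to [seq_term (γ + 1)]. *)
Record sc_reduction {C : Type} (bot : C) (R : relation (term C))
    (ζ : ordinal) (s t : term C) : Type := {
  seq_term : upto ζ -> term C;
  seq_depth : ζ -> nat;
  seq_start : forall x, is_zero x -> seq_term x ≡ s;
  seq_end : seq_term None ≡ t;
  seq_step : forall (γ : ζ) (γ' : upto ζ), is_succ (Some γ) γ' ->
    compat_at R (seq_depth γ) (seq_term (Some γ)) (seq_term γ');
  seq_conv : forall δ : upto ζ, is_limit δ ->
    forall eps, (0 < eps)%R ->
    exists γ, upto_lt γ δ /\
      forall γ', upto_le γ γ' -> upto_lt γ' δ ->
        (term_dist bot (seq_term γ') (seq_term δ) < eps)%R;
  seq_strong : forall δ : upto ζ, is_limit δ -> forall d : nat,
    exists γ : upto ζ, upto_lt γ δ /\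
      forall γ' : ζ, upto_le γ (Some γ') -> upto_lt (Some γ') δ ->
        (d < seq_depth γ')%nat
}.

#[export] Instance bisim_equiv (C : Type) : Equivalence (@bisim C).
Proof.
  split.
  - cofix IH. intros [i|c|u v|u]; constructor; apply IH.
  - cofix IH. intros s t H. destruct H; constructor; now apply IH.
  - cofix IH. intros s t u H H'.
    destruct H; inversion H'; subst; constructor; eapply IH; eassumption.
Qed.

Lemma compat_iff_at (C : Type) (R : relation (term C)) (s t : term C) :
  compat R s t <-> exists n, compat_at R n s t.
Proof.
  split.
  - induction 1 as [s t H|s s' t t' _ [n IH] E|s s' t t' E _ [n IH]|s s' _ [n IH]];
      eexists; econstructor; eassumption.
  - intros [n H]. induction H; econstructor; eassumption.
Qed.

Lemma compat_proper (C : Type) (R : relation (term C)) :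
  Proper (bisim ==> bisim ==> iff) R ->
  Proper (bisim ==> bisim ==> iff) (compat R).
Proof.
  intros HR.
  assert (K : forall s t, compat R s t ->
            forall s' t', s ≡ s' -> t ≡ t' -> compat R s' t').
  { induction 1 as [s t H|s s1 t t1 H IH E|s s1 t t1 E H IH|s s1 H IH];
      intros s' t' Es Et.
    - apply compat_base. now apply (HR s s' Es t t' Et).
    - inversion Es; inversion Et; subst. apply compat_appl; [apply IH; assumption|].
      transitivity t; [now symmetry|now transitivity t1].
    - inversion Es; inversion Et; subst. apply compat_appr; [|apply IH; assumption].
      transitivity s; [now symmetry|now transitivity s1].
    - inversion Es; inversion Et; subst. apply compat_lam. apply IH; assumption. }
  intros s s' Es t t' Et. split; intros H.
  - eapply K; eassumption.
  - eapply K; [eassumption|now symmetry..].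
Qed.

(* Main.v *)
Require Import Defs.
From Stdlib Require Import Relations Morphisms.
From Stdlib Require Import Reals Lra Lia Arith Classical ClassicalEpsilon Eqdep_dec.
From Coquelicot Require Import Rbar Lub.

(** From a reduction sequence [f] to [→∞]: by transfinite induction on [β],
    [s →∞ f α] implies [s →∞ f β].  Successors are appendability.  At a limit,
    a tail of the sequence contracts only redexes below the root, so that it
    projects to sequences between the children of the root, and one concludes
    by coinduction.  The projections may idle, hence idle steps are allowed.

    Conversely, [s →∞ t] yields a reduction that fixes [t] down to depth
    [1, 2, 3, ...] by finitely many steps each, the [n]-th block being at depth
    at least [n].  If [s] does not reach [t] in finitely many steps, then
    infinitely many blocks are nonempty and they concatenate to a sequence of
    length [ω]. *)

Local Open Scope nat_scope.
Local Open Scope term_scope.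

Set Implicit Arguments.
Set Bullet Behavior "Strict Subproofs".

#[local] Arguments seq_term {C bot R ζ s t}.
#[local] Arguments seq_depth {C bot R ζ s t}.
#[local] Arguments seq_start {C bot R ζ s t}.
#[local] Arguments seq_end {C bot R ζ s t}.
#[local] Arguments seq_step {C bot R ζ s t}.
#[local] Arguments seq_conv {C bot R ζ s t}.
#[local] Arguments seq_strong {C bot R ζ s t}.

(** * Truncation and the metric *)

Section Metric.
Context {C : Type} (bot : C).
Implicit Types s t : term C.

Lemma trunc_bisim n s t : s ≡ t -> trunc bot n s ≡ trunc bot n t.
Proof.
  revert s t; induction n as [|n IH]; intros s t E; simpl; [reflexivity|].
  destruct E; constructor; now apply IH.
Qed.

Lemma trunc_le n m s t :
  n <= m -> trunc bot m s ≡ trunc bot m t -> trunc bot n s ≡ trunc bot n t.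
Proof.
  revert m s t; induction n as [|n IH]; intros [|m] s t L E; simpl;
    try reflexivity; try lia.
  destruct s, t; simpl in E; inversion E; subst; constructor;
    apply (IH m); trivial; lia.
Qed.

Lemma bisim_of_trunc s t :
  (forall n, trunc bot n s ≡ trunc bot n t) -> s ≡ t.
Proof.
  revert s t; cofix IH; intros s t H.
  (* Truncation at depth 0 forgets the root, so only positive depths carry information. *)
  assert (K : forall n, trunc bot (S n) s ≡ trunc bot (S n) t)
    by (intros n; apply H).
  clear H; pose proof (K 0) as K0.
  destruct s as [i|c|s1 s2|s1], t as [j|e|t1 t2|t1]; simpl in K0;
    try (exfalso; inversion K0; fail).
  - assert (i = j) as -> by now inversion K0. constructor.
  - assert (c = e) as -> by now inversion K0. constructor.
  - constructor; apply IH; intros n; specialize (K n); inversion K; assumption.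
  - constructor; apply IH; intros n; specialize (K n); inversion K; assumption.
Qed.

Let agreement s t (x : R) : Prop :=
  exists n : nat, trunc bot n t ≡ trunc bot n s /\ x = (/ 2 ^ n)%R.

Lemma pow2_pos n : (0 < 2 ^ n)%R.
Proof. apply pow_lt; lra. Qed.

(** [real] sends both infinities to 0, so the infimum must first be shown finite: the set contains
    [2^0], and 0 is a lower bound. *)
Lemma term_dist_glb s t :
  is_glb_Rbar (agreement t s) (Finite (term_dist bot s t)).
Proof.
  unfold term_dist; fold (agreement t s).
  pose proof (Glb_Rbar_correct (agreement t s)) as [LB GLB].
  destruct (Glb_Rbar (agreement t s)) as [r| |] eqn:E.
  - split; assumption.
  - exfalso. specialize (LB (/ 2 ^ 0)%R). simpl in LB; apply LB.
    exists 0; split; reflexivity.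
  - exfalso. apply (GLB (Finite 0)). intros x [n [_ ->]]; simpl.
    left; apply Rinv_0_lt_compat, pow2_pos.
Qed.

Lemma term_dist_le s t n :
  trunc bot n s ≡ trunc bot n t -> (term_dist bot s t <= / 2 ^ n)%R.
Proof.
  intros E. destruct (term_dist_glb s t) as [LB _].
  apply (LB (/ 2 ^ n)%R). now exists n.
Qed.

(** If the truncations at depth [n] differ, agreement occurs only at depths [m < n], so [2^-n] is a
    lower bound of the set and hence at most the distance. *)
Lemma trunc_of_term_dist s t n :
  (term_dist bot s t < / 2 ^ n)%R -> trunc bot n s ≡ trunc bot n t.
Proof.
  intros L. apply NNPP; intros N. destruct (term_dist_glb s t) as [_ GLB].
  enough (Rbar_le (Finite (/ 2 ^ n)) (Finite (term_dist bot s t))) as K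
    by (simpl in K; lra).
  apply GLB. intros x [m [E ->]]; simpl.
  assert (m < n).
  { apply not_le; intros K. apply N. now apply (@trunc_le n m). }
  apply Rinv_le_contravar; [apply pow2_pos|].
  apply Rle_pow; [lra|lia].
Qed.

Lemma pow2_inv_small (eps : R) : (0 < eps)%R -> exists n, (/ 2 ^ n < eps)%R.
Proof.
  intros H. destruct (pow_lt_1_zero (/ 2)) with (y := eps) as [n Hn]; trivial.
  - rewrite Rabs_pos_eq; lra.
  - exists n. specialize (Hn n (Nat.le_refl n)).
    rewrite pow_inv in Hn. rewrite Rabs_pos_eq in Hn; trivial.
    left; apply Rinv_0_lt_compat, pow2_pos.
Qed.

End Metric.

(** * The infinitary closure *)

Section Closure.
Context {C : Type}.
Implicit Types s t u : term C.

(** Coinduction by exhibiting a relation closed under one unfolding. Later proofs can then invoke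
    arbitrary lemmas without endangering guardedness. *)
Lemma infcl_coind (step : relation (term C)) (X : relation (term C)) :
  (forall s t, X s t ->
     match t with
     | App t1' t2' => exists t1 t2,
         star step s (App t1 t2) /\ X t1 t1' /\ X t2 t2'
     | Lam r' => exists r, star step s (Lam r) /\ X r r'
     | _ => star step s t
     end) ->
  forall s t, X s t -> infcl step s t.
Proof.
  intros HX; cofix IH; intros s t H; apply HX in H.
  destruct t as [i|c|t1' t2'|r'].
  - now apply infcl_atom.
  - now apply infcl_atom.
  - destruct H as (t1 & t2 & H & H1 & H2).
    apply infcl_app with t1 t2; [assumption|now apply IH..].
  - destruct H as (r & H & H1).
    apply infcl_lam with r; [assumption|now apply IH].
Qed.

Lemma infcl_inv (step : relation (term C)) s t :
  infcl step s t ->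
  match t with
  | App t1' t2' => exists t1 t2,
      star step s (App t1 t2) /\ infcl step t1 t1' /\ infcl step t2 t2'
  | Lam r' => exists r, star step s (Lam r) /\ infcl step r r'
  | _ => star step s t
  end.
Proof.
  intros [s' a A H|s' t1 t2 t1' t2' H H1 H2|s' r r' H H1]; eauto.
  destruct a; simpl in A; tauto.
Qed.

Lemma infcl_bisim_r (step : relation (term C)) s t t' :
  infcl step s t -> t ≡ t' -> infcl step s t'.
Proof.
  intros H E.
  apply infcl_coind with (X := fun s t' => exists t, infcl step s t /\ t ≡ t');
    [clear|now exists t].
  intros s t' (t & H & E). apply infcl_inv in H. destruct E; [exact H|exact H|..].
  - destruct H as (t1 & t2 & H & H1 & H2). exists t1, t2; eauto 7.
  - destruct H as (r & H & H1). exists r; eauto 7.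
Qed.

Context (R : relation (term C)) (R_bisim : Proper (bisim ==> bisim ==> iff) R).

Lemma star_bisim_l s s' t :
  s ≡ s' -> star (compat R) s' t -> star (compat R) s t.
Proof.
  intros E H; destruct H as [s' t H|s' u t H K].
  - apply star_refl. now transitivity s'.
  - apply star_step with u; trivial.
    eapply compat_proper; [eassumption|eassumption|reflexivity|assumption].
Qed.

Lemma infcl_bisim_l s s' t :
  s ≡ s' -> infcl (compat R) s' t -> infcl (compat R) s t.
Proof.
  intros E H; destruct H as [s1 a A H|s1 t1 t2 t1' t2' H H1 H2|s1 r r' H H1].
  - apply infcl_atom; eauto using star_bisim_l.
  - apply infcl_app with t1 t2; eauto using star_bisim_l.
  - apply infcl_lam with r; eauto using star_bisim_l.
Qed.

End Closure.

(** * From reduction sequences to the infinitary closure *)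

Section Ordinals.
Context {ζ : ordinal}.
Implicit Types x y z : upto ζ.

Lemma upto_lt_trans x y z : upto_lt x y -> upto_lt y z -> upto_lt x z.
Proof.
  destruct x, y, z; simpl; try tauto. exact (Defs.ord_trans ζ _ _ _).
Qed.

Lemma upto_le_trans x y z : upto_le x y -> upto_le y z -> upto_le x z.
Proof.
  intros [H| ->] [K| ->]; unfold upto_le; eauto using upto_lt_trans.
Qed.

Lemma upto_le_lt_trans x y z : upto_le x y -> upto_lt y z -> upto_lt x z.
Proof. intros [H| ->]; eauto using upto_lt_trans. Qed.

Lemma upto_lt_le_trans x y z : upto_lt x y -> upto_le y z -> upto_lt x z.
Proof. intros H [K| <-]; eauto using upto_lt_trans. Qed.

Lemma upto_le_total x y : upto_le x y \/ upto_le y x.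
Proof.
  unfold upto_le; destruct x as [a|], y as [b|]; simpl; auto.
  destruct (ord_total ζ a b) as [|[->|]]; auto.
Qed.

Lemma upto_wf : well_founded (@upto_lt ζ).
Proof.
  assert (K : forall a : ζ, Acc upto_lt (Some a)).
  { intros a; induction a as [a IH] using (well_founded_ind (ord_wf ζ)).
    constructor; intros [b|]; simpl; [apply IH|tauto]. }
  intros [a|]; [apply K|]. constructor; intros [b|]; simpl; [|tauto].
  intros _; apply K.
Qed.

Lemma upto_max_lt x y z :
  upto_lt x z -> upto_lt y z ->
  exists w, upto_le x w /\ upto_le y w /\ upto_lt w z.
Proof.
  destruct (upto_le_total x y); [exists y|exists x]; repeat split; trivial;
    now right.
Qed.

Lemma upto_cases x y :
  upto_lt x y -> is_limit y \/ exists z, is_succ z y /\ upto_le x z.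
Proof.
  intros L. destruct (classic (exists z, is_succ z y)) as [[z S]|N].
  - right; exists z; split; trivial.
    destruct (upto_le_total x z) as [H|[H| ->]]; trivial; [|now right].
    destruct (proj2 S x); now split.
  - left; split; trivial. intros Z; exact (Z x L).
Qed.

Lemma upto_has_zero : exists x : upto ζ, is_zero x.
Proof.
  apply NNPP; intros N.
  assert (F : forall x : upto ζ, False).
  { intros x; induction x as [x IH] using (well_founded_ind upto_wf).
    apply N; exists x; exact IH. }
  exact (F None).
Qed.

End Ordinals.

(** * Convergent reductions with idle steps and their projections *)

Section Convergent.
Context {C : Type} (bot : C) (R : relation (term C)).
Implicit Types s t u : term C.

Definition step_ge n s t : Prop :=
  s ≡ t \/ exists m, n <= m /\ compat_at R m s t.

(* The part from [α] to [β] of a strongly convergent reduction with idle steps. *)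
Record convergent {ζ : ordinal} (f : upto ζ -> term C) (α β : upto ζ) : Prop := {
  convergent_step : forall γ γ',
    upto_le α γ -> is_succ γ γ' -> upto_le γ' β -> step_ge 0 (f γ) (f γ');
  convergent_limit : forall δ, upto_lt α δ -> upto_le δ β -> is_limit δ ->
    forall d, exists γ, upto_le α γ /\ upto_lt γ δ /\
      (forall γ', upto_le γ γ' -> upto_lt γ' δ ->
         trunc bot d (f γ') ≡ trunc bot d (f δ)) /\
      (forall γ' γ'', upto_le γ γ' -> is_succ γ' γ'' -> upto_le γ'' δ ->
         step_ge d (f γ') (f γ''))
}.

Lemma convergent_of_sc_reduction (ζ : ordinal) s t (r : sc_reduction bot R ζ s t) α :
  convergent (seq_term r) α None.
Proof.
  split.
  - intros [γ|] γ' _ S _; [|now destruct S].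
    right; exists (seq_depth r γ); split; [lia|]. now apply seq_step.
  - intros δ Lδ _ D d.
    (* Distance below [2^-d] gives agreement of the truncations at depth [d]. *)
    destruct (seq_conv r δ D (/ 2 ^ d)) as (γ1 & L1 & H1);
      [apply Rinv_0_lt_compat, pow2_pos|].
    destruct (seq_strong r δ D d) as (γ2 & L2 & H2).
    (* A common index past [α] and both thresholds serves the two tail conditions. *)
    destruct (upto_max_lt _ _ _ L1 L2) as (γ3 & K1 & K2 & L3).
    destruct (upto_max_lt _ _ _ Lδ L3) as (γ & K & K3 & L).
    exists γ; split; [assumption|]; split; [assumption|]; split.
    + intros γ' Lγ Lγ'. apply trunc_of_term_dist, H1; trivial.
      eauto using upto_le_trans.
    + intros [γ'|] γ'' Lγ S Lγ''; [|now destruct S].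
      right; exists (seq_depth r γ'); split; [|now apply seq_step].
      apply Nat.lt_le_incl, H2; [eauto using upto_le_trans|].
      eapply upto_lt_le_trans; [apply S|assumption].
Qed.

Lemma convergent_initial (ζ : ordinal) (f : upto ζ -> term C) α β β' :
  upto_le β' β -> convergent f α β -> convergent f α β'.
Proof.
  intros L [H1 H2]; split.
  - intros; apply H1; eauto using upto_le_trans.
  - intros; apply H2; eauto using upto_le_trans.
Qed.

(* Projections to a child of the root; junk [Var 0] for other root symbols. *)
Definition app_left t := match t with App u _ => u | _ => Var 0 end.
Definition app_right t := match t with App _ v => v | _ => Var 0 end.
Definition lam_body t := match t with Lam u => u | _ => Var 0 end.

(** Collects what the descent below the root needs of a projection, so that the three projections
    are treated at once. *)
Definition child (p : term C -> term C) : Prop :=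
  (forall n s t, step_ge (S n) s t -> step_ge n (p s) (p t)) /\
  (forall d s t, trunc bot (S d) s ≡ trunc bot (S d) t ->
     trunc bot d (p s) ≡ trunc bot d (p t)).

(** A contraction at positive depth keeps the root symbol and takes place in one child, one level
    higher there; under an application the other child idles. *)
Lemma children : child app_left /\ child app_right /\ child lam_body.
Proof.
  assert (B : forall n s t, s ≡ t -> step_ge n s t) by now left.
  assert (K : forall n m s t, S n <= S m -> compat_at R m s t -> step_ge n s t)
    by (intros n m s t L H; right; exists m; split; [lia|assumption]).
  repeat split;
    try (intros n s t [E|([|m] & L & H)];
         [destruct E; apply B; simpl; trivial; reflexivity
         |lia
         |inversion H; subst; simpl; eauto; apply B; reflexivity]);
    intros d s t E; destruct s, t; simpl in E; inversion E; subst; simpl;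
      trivial; reflexivity.
Qed.

Lemma convergent_child (ζ : ordinal) (f : upto ζ -> term C) α γ β p :
  child p -> convergent f α β -> upto_le α γ ->
  (forall γ' γ'', upto_le γ γ' -> is_succ γ' γ'' -> upto_le γ'' β ->
     step_ge 1 (f γ') (f γ'')) ->
  convergent (fun x => p (f x)) γ β.
Proof.
  intros [P1 P2] [_ H] L K; split.
  - intros; apply P1; auto.
  - intros δ Lδ Lβ D d.
    (* Depth [S d] is requested because the projection loses one level. *)
    destruct (H δ (upto_le_lt_trans _ L Lδ) Lβ D (S d)) as (γ0 & _ & L1 & H1 & H2).
    destruct (upto_max_lt _ _ _ Lδ L1) as (γ1 & M1 & M2 & M3).
    exists γ1; split; [assumption|]; split; [assumption|]; split; intros.
    + apply P2, H1; eauto using upto_le_trans.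
    + apply P1, H2; eauto using upto_le_trans.
Qed.

Context (R_app : appendable (compat R)).

(** Transfinite induction on [β] with a coinduction nested in the limit case. [s], [f] and [α] are
    quantified under the induction because its hypothesis is applied to prefixes of projected
    sequences. *)
Lemma infcl_convergent (ζ : ordinal) (β : upto ζ) :
  forall s f α, upto_le α β -> convergent f α β ->
    infcl (compat R) s (f α) -> infcl (compat R) s (f β).
Proof.
  induction β as [β IH] using (well_founded_ind upto_wf).
  intros s f α [L| ->] H K; [|assumption].
  destruct (upto_cases _ _ L) as [D|(γ & S & Lγ)].
  (* The limit [β] stays fixed while the sequence and its start vary, so that the projections to the
     children fall under [X] again. *)
  - apply infcl_coind with (X := fun s t => exists f α, upto_lt α β /\
      convergent f α β /\ infcl (compat R) s (f α) /\ f β = t);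
      [|now exists f, α].
    clear s f α L H K. intros s t (f & α & L & H & K & <-).
    (* From [γ] on, the root symbol is that of [f β] and no redex is contracted at the root. Since
       [γ < β], the induction hypothesis reaches [f γ]. *)
    destruct (convergent_limit H L (or_intror eq_refl) D 1)
      as (γ & Lα & Lγ & T & St).
    specialize (T γ (or_intror eq_refl) Lγ).
    assert (Ks : infcl (compat R) s (f γ)).
    { apply (IH γ Lγ s f α); trivial.
      apply convergent_initial with β; trivial. now left. }
    apply infcl_inv in Ks.
    destruct children as (Pl & Pr & Pb).
    pose proof (convergent_child Pl H Lα St) as Hl.
    pose proof (convergent_child Pr H Lα St) as Hr.
    pose proof (convergent_child Pb H Lα St) as Hb.
    destruct (f γ) as [i|c|a1 a2|a] eqn:Eγ, (f β) as [j|e|b1 b2|b] eqn:Eβ;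
      simpl in T; try (exfalso; inversion T; fail).
    + inversion T; subst; assumption.
    + inversion T; subst; assumption.
    + destruct Ks as (u1 & u2 & Ks & K1 & K2).
      exists u1, u2; split; [assumption|split].
      * exists (fun x => app_left (f x)), γ; rewrite Eγ, Eβ; auto.
      * exists (fun x => app_right (f x)), γ; rewrite Eγ, Eβ; auto.
    + destruct Ks as (u & Ks & K1). exists u; split; [assumption|].
      exists (fun x => lam_body (f x)), γ; rewrite Eγ, Eβ; auto.
  - assert (Ks : infcl (compat R) s (f γ)).
    { apply (IH γ (proj1 S) s f α); trivial.
      apply convergent_initial with β; trivial. left; apply S. }
    destruct (convergent_step H Lγ S (or_intror eq_refl)) as [E|(m & _ & St)].
    + now apply infcl_bisim_r with (f γ).
    + apply R_app with (f γ); trivial. apply compat_iff_at; now exists m.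
Qed.

Lemma infcl_of_bisim s t : s ≡ t -> infcl (compat R) s t.
Proof.
  apply infcl_coind with (X := bisim). intros u v [i|c|u1 v1 u2 v2 E1 E2|u1 v1 E].
  - apply star_refl; reflexivity.
  - apply star_refl; reflexivity.
  - exists u1, u2; split; [apply star_refl; reflexivity|now split].
  - exists u1; split; [apply star_refl; reflexivity|trivial].
Qed.

Lemma infcl_of_sc_reduction (ζ : ordinal) s t :
  sc_reduction bot R ζ s t -> infcl (compat R) s t.
Proof.
  intros r. apply infcl_bisim_r with (seq_term r None); [|apply seq_end].
  destruct (@upto_has_zero ζ) as [x Z].
  apply (@infcl_convergent ζ None s (seq_term r) x).
  - destruct x as [a|]; [now left|now right].
  - apply convergent_of_sc_reduction.
  - apply infcl_of_bisim. symmetry. now apply seq_start.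
Qed.

End Convergent.

(** * From the infinitary closure to reduction sequences *)

Section Sequences.
Context {C : Type} (bot : C) (R : relation (term C))
  (R_bisim : Proper (bisim ==> bisim ==> iff) R).
Implicit Types s t u v : term C.

(** The number [k] of contractions is explicit because it later serves as the measure that decreases
    inside a block. *)
Fixpoint red_ge n k u v : Prop :=
  match k with
  | 0 => u ≡ v
  | S k => exists m w, n <= m /\ compat_at R m u w /\ red_ge n k w v
  end.

(* [u] agrees with [t] above depth [n], where the subterms are related by [→∞]. *)
Fixpoint infcl_at n u t : Prop :=
  match n with
  | 0 => infcl (compat R) u t
  | S n =>
      match u, t with
      | Var i, Var j => i = j
      | Cst c, Cst e => c = e
      | App u1 u2, App t1 t2 => infcl_at n u1 t1 /\ infcl_at n u2 t2
      | Lam u, Lam t => infcl_at n u t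
      | _, _ => False
      end
  end.

Lemma red_ge_app n j k u u' v v' :
  red_ge n j u u' -> red_ge n k v v' ->
  red_ge (S n) (j + k) (App u v) (App u' v').
Proof.
  intros H; revert u H; induction j as [|j IHj]; simpl.
  - intros u E. revert v; induction k as [|k IHk]; simpl; intros v.
    + now constructor.
    + intros (m & w & L & H & K). exists (S m), (App u w). repeat split.
      * lia.
      * now constructor.
      * now apply IHk.
  - intros u (m & w & L & H & K) Hv. exists (S m), (App w v). repeat split.
    + lia.
    + now constructor.
    + now apply IHj.
Qed.

Lemma red_ge_lam n k u u' :
  red_ge n k u u' -> red_ge (S n) k (Lam u) (Lam u').
Proof.
  revert u; induction k as [|k IH]; simpl; intros u.
  - now constructor.
  - intros (m & w & L & H & K). exists (S m), (Lam w). repeat split.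
    + lia.
    + now constructor.
    + now apply IH.
Qed.

Lemma red_ge_of_star u v : star (compat R) u v -> exists k, red_ge 0 k u v.
Proof.
  induction 1 as [u v E|u w v H _ [k IH]].
  - now exists 0.
  - apply compat_iff_at in H as [m H]. exists (S k), m, w. split; [lia|auto].
Qed.

Lemma infcl_at_bisim_l n u u' t :
  u ≡ u' -> infcl_at n u' t -> infcl_at n u t.
Proof.
  revert u u' t; induction n as [|n IH]; simpl; intros u u' t E.
  - now apply infcl_bisim_l.
  - destruct E, t; trivial; intuition eauto.
Qed.

Lemma infcl_at_trunc n u t : infcl_at n u t -> trunc bot n u ≡ trunc bot n t.
Proof.
  revert u t; induction n as [|n IH]; simpl; intros u t H; [reflexivity|].
  destruct u, t; try tauto; subst; constructor; apply IH; tauto.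
Qed.

Lemma compat_at_trunc n m u v :
  n <= m -> compat_at R m u v -> trunc bot n u ≡ trunc bot n v.
Proof.
  intros L H; revert n L; induction H; intros [|n'] L; simpl; try reflexivity;
    try lia; constructor; try apply IHcompat_at; try lia; now apply trunc_bisim.
Qed.

Lemma red_ge_trunc n k u v : red_ge n k u v -> trunc bot n u ≡ trunc bot n v.
Proof.
  revert u; induction k as [|k IH]; simpl; intros u.
  - apply trunc_bisim.
  - intros (m & w & L & H & K). transitivity (trunc bot n w); [|auto].
    eapply compat_at_trunc; eassumption.
Qed.

(** One block: at each of the finitely many positions of depth [n], the closure supplies a finite
    reduction to the root symbol of [t]. In context these contractions lie at depth at least [n]. *)
Lemma infcl_at_deepen n u t :
  infcl_at n u t -> exists k v, red_ge n k u v /\ infcl_at (S n) v t.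
Proof.
  revert u t; induction n as [|n IH]; intros u t H.
  - apply infcl_inv in H.
    assert (K : exists v, star (compat R) u v /\ infcl_at 1 v t).
    { destruct t as [i|c|t1 t2|t].
      - now exists (Var i).
      - now exists (Cst c).
      - destruct H as (u1 & u2 & H & H1 & H2). now exists (App u1 u2).
      - destruct H as (u1 & H & H1). now exists (Lam u1). }
    destruct K as (v & K & Hv). apply red_ge_of_star in K as [k K].
    now exists k, v.
  - destruct u as [i|c|u1 u2|u], t as [j|e|t1 t2|t]; simpl in H; try tauto.
    + exists 0, (Var i); split; [reflexivity|assumption].
    + exists 0, (Cst c); split; [reflexivity|assumption].
    + destruct H as [H1 H2].
      apply IH in H1 as (k1 & v1 & H1 & K1), H2 as (k2 & v2 & H2 & K2).
      exists (k1 + k2), (App v1 v2); split; [now apply red_ge_app|now split].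
    + apply IH in H as (k & v & H & K).
      exists k, (Lam v); split; [now apply red_ge_lam|assumption].
Qed.

(** If all blocks from depth [n] on were empty, [u] would agree with [t] to every depth and so be
    bisimilar to it. *)
Lemma infcl_at_next n u t :
  infcl_at n u t -> ~ u ≡ t ->
  exists m k v, n <= m /\ red_ge m (S k) u v /\ infcl_at (S m) v t.
Proof.
  intros H N. apply NNPP; intros F. apply N, (@bisim_of_trunc _ bot); intros d.
  assert (K : forall j, infcl_at (j + n) u t).
  { induction j as [|j IH]; [assumption|].
    destruct (infcl_at_deepen _ _ _ IH) as (k & v & K & Hv).
    destruct k as [|k]; [simpl in K; now apply infcl_at_bisim_l with v|].
    exfalso; apply F. exists (j + n), k, v; split; [lia|now split]. }
  apply trunc_le with (d + n); [lia|]. now apply infcl_at_trunc.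
Qed.

(** * Reduction sequences of length [ω] *)

Lemma sc_reduction_omega (u : nat -> term C) (d n : nat -> nat) t :
  (forall i, compat_at R (d i) (u i) (u (S i))) ->
  (forall i, n i <= d i) ->
  (forall i, trunc bot (n i) (u i) ≡ trunc bot (n i) t) ->
  (forall N, exists i, forall j, i <= j -> N < n j) ->
  sc_reduction bot R omega (u 0) t.
Proof.
  intros Hu Hd Ht Hn.
  assert (Lim : forall δ : upto omega, is_limit δ -> δ = None).
  { intros [[|i]|] [Z S]; trivial; exfalso.
    - apply Z. intros [j|]; simpl; [lia|tauto].
    - apply S. exists (Some i); split; simpl; [lia|].
      intros [j|]; simpl; [lia|tauto]. }
  refine {| seq_term := fun x : upto omega =>
              match x with Some i => u i | None => t end;
            seq_depth := fun i : omega => d i |}.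
  - intros [[|i]|] Z.
    + reflexivity.
    + exfalso; apply (Z (Some 0)); simpl; lia.
    + exfalso; now apply (Z (Some 0)).
  - reflexivity.
  - intros i [j|] [L S]; simpl in L.
    + assert (j = Datatypes.S i) as ->; [|apply Hu].
      destruct (le_lt_dec j (Datatypes.S i)); [lia|].
      destruct (S (Some (Datatypes.S i))); simpl; lia.
    (* [None] is not a successor: the index following [i] lies strictly between. *)
    + destruct (S (Some (Datatypes.S i))); simpl; split; [lia|trivial].
  - intros δ D eps He. rewrite (Lim δ D).
    destruct (pow2_inv_small He) as [N HN].
    destruct (Hn N) as [i Hi]. exists (Some i); split; [exact I|].
    intros [j|] Lj Lj'; [|now destruct Lj'].
    apply Rle_lt_trans with (/ 2 ^ N)%R; [|assumption].
    apply term_dist_le. apply trunc_le with (n j); [|apply Ht].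
    apply Nat.lt_le_incl, Hi. destruct Lj as [Lj|Lj]; simpl in Lj; [lia|].
    injection Lj; lia.
  - intros δ D N. rewrite (Lim δ D).
    destruct (Hn N) as [i Hi]. exists (Some i); split; [exact I|].
    intros j Lj _. apply Nat.lt_le_trans with (n j); [|apply Hd].
    apply Hi. destruct Lj as [Lj|Lj]; simpl in Lj; [lia|].
    injection Lj; lia.
Qed.

(* A point inside the block of depth [level], with [steps] contractions of the
   block still to be done. *)
Record state (t : term C) : Type := {
  level : nat;
  steps : nat;
  point : term C;
  state_red : exists v, red_ge level steps point v /\ infcl_at (S level) v t;
  state_infinite : ~ star (compat R) point t
}.

(** The pair of level and steps left moves lexicographically. The depth is compared with the level
    of the target, since the contraction that opens a block already belongs to it. *)
Definition state_step t (x y : state t) : Prop :=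
  exists m, level y <= m /\ compat_at R m (point x) (point y) /\
    (level x = level y /\ steps y < steps x \/ level x < level y).

Lemma state_progress t (x : state t) : exists y, state_step x y.
Proof.
  destruct x as [n k u H N].
  assert (K : exists n' k' v, red_ge n' (S k') u v /\ infcl_at (S n') v t /\
            (n = n' /\ k' < k \/ n < n')).
  { destruct H as (v & H & Hv). destruct k as [|k].
    (* The block is used up, so the next nonempty one is entered, at a strictly larger level; [u] is
       not yet [t] because it does not reach [t] in finitely many steps. *)
    - destruct (@infcl_at_next (S n) u t) as (n' & k' & v' & L & K & K').
      + now apply infcl_at_bisim_l with v.
      + intros E; apply N; now apply star_refl.
      + exists n', k', v'; auto.
    - exists n, k, v; repeat split; auto. }
  destruct K as (n' & k' & v & (m & w & L & St & K) & Kv & J).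
  assert (Nw : ~ star (compat R) w t).
  { intros F; apply N. apply star_step with w; trivial.
    apply compat_iff_at; now exists m. }
  exists (@Build_state t n' k' w (ex_intro _ v (conj K Kv)) Nw).
  now exists m.
Qed.

(** The level never drops, and while it stays constant [k] decreases, so it must rise again and
    again. *)
Lemma lex_unbounded (n k : nat -> nat) :
  (forall i, n i = n (S i) /\ k (S i) < k i \/ n i < n (S i)) ->
  forall N, exists i, forall j, i <= j -> N < n j.
Proof.
  intros H.
  assert (M : forall i j, i <= j -> n i <= n j).
  { intros i j L; induction L as [|j L IH]; [lia|]. specialize (H j); lia. }
  (* [b] bounds the number of steps before the next rise. *)
  assert (U : forall b i, k i <= b -> exists j, n i < n j).
  { induction b as [|b IH]; intros i Hb; destruct (H i) as [[E L]|L].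
    - lia.
    - now exists (S i).
    - destruct (IH (S i)) as [j Hj]; [lia|]. exists j; lia.
    - now exists (S i). }
  assert (V : forall N, exists i, N < n i).
  { induction N as [|N [i Hi]].
    - destruct (U (k 0) 0) as [j Hj]; [lia|]. exists j; lia.
    - destruct (U (k i) i) as [j Hj]; [lia|]. exists j; lia. }
  intros N. destruct (V N) as [i Hi]. exists i; intros j L.
  specialize (M i j L); lia.
Qed.

Lemma sc_reduction_infinite s t :
  infcl (compat R) s t -> ~ star (compat R) s t ->
  inhabited (sc_reduction bot R omega s t).
Proof.
  intros H N.
  destruct (infcl_at_deepen 0 s t H) as (k & v & K & Hv).
  (* The block at level 0 may be empty; [state_progress] then passes to a nonempty one. *)
  pose (x0 := @Build_state t 0 k s (ex_intro _ v (conj K Hv)) N).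
  pose (next := fun x : state t =>
    proj1_sig (constructive_indefinite_description _ (state_progress x))).
  pose (x := fun i => Nat.iter i next x0).
  assert (Hx : forall i, state_step (x i) (x (S i))).
  { intros i; unfold x; simpl; unfold next at 1.
    apply proj2_sig. }
  pose (m := fun i => constructive_indefinite_description _ (Hx i)).
  constructor.
  (* The level is taken at [S i]: contraction [i] and the rest of its block leave everything above
     that depth unchanged, so [point (x i)] already agrees with [t] there. *)
  apply (@sc_reduction_omega (fun i => point (x i)) (fun i => proj1_sig (m i))
           (fun i => level (x (S i)))).
  - intros i; apply (proj2_sig (m i)).
  - intros i; apply (proj2_sig (m i)).
  - intros i. destruct (proj2_sig (m i)) as (L & St & _).
    transitivity (trunc bot (level (x (S i))) (point (x (S i)))).
    + exact (compat_at_trunc L St).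
    + destruct (state_red (x (S i))) as (w & Kw & Hw).
      transitivity (trunc bot (level (x (S i))) w).
      * exact (red_ge_trunc _ _ _ _ Kw).
      * apply trunc_le with (S (level (x (S i)))); [lia|].
        now apply infcl_at_trunc.
  - apply lex_unbounded with (fun i => steps (x (S i))).
    intros i; destruct (Hx (S i)) as (m' & _ & _ & J); exact J.
Qed.

(** * Finite ordinals and finite reduction sequences *)

Lemma fin_total n (x y : {i | i <? n = true}) :
  proj1_sig x < proj1_sig y \/ x = y \/ proj1_sig y < proj1_sig x.
Proof.
  destruct x as [i p], y as [j q]; simpl.
  destruct (Nat.lt_trichotomy i j) as [|[->|]]; auto.
  right; left; f_equal. apply UIP_dec, Bool.bool_dec.
Qed.

(** The bound is a boolean equation because its proofs are unique, so that equal numbers give equal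
    elements, as [ord_total] demands. *)
Definition fin (n : nat) : ordinal :=
  Ordinal {i | i <? n = true} (fun x y => proj1_sig x < proj1_sig y)
    (fun x y z => Nat.lt_trans _ _ _) (@fin_total n)
    (Wf_nat.well_founded_ltof _ (@proj1_sig _ _)).

Lemma fin_le_omega n : ord_le (fin n) omega.
Proof.
  exists (fun x : fin n => proj1_sig x : omega); split; [trivial|].
  intros [i p] j L; simpl in *. apply Nat.ltb_lt in p.
  assert (q : j <? n = true) by (apply Nat.ltb_lt; lia).
  now exists (exist _ j q).
Qed.

(** Turns order and successors in [upto (fin n)] into arithmetic on [0, ..., n]. *)
Definition fin_index n (x : upto (fin n)) : nat :=
  match x with Some i => proj1_sig i | None => n end.

Lemma fin_index_lt n (x y : upto (fin n)) :
  upto_lt x y <-> fin_index x < fin_index y.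
Proof.
  destruct x as [[i p]|], y as [[j q]|]; simpl; try tauto;
    rewrite ?Nat.ltb_lt in *; lia.
Qed.

Lemma fin_index_onto n i (y : upto (fin n)) :
  i < fin_index y -> exists x, @fin_index n (Some x) = i.
Proof.
  intros L. assert (q : i <? n = true).
  { apply Nat.ltb_lt. destruct y as [[j p]|]; simpl in L; trivial.
    apply Nat.ltb_lt in p; lia. }
  now exists (exist _ i q).
Qed.

Lemma fin_index_succ n (x y : upto (fin n)) :
  is_succ x y <-> fin_index y = S (fin_index x).
Proof.
  split.
  - intros [L H]. apply fin_index_lt in L.
    destruct (Nat.eq_dec (fin_index y) (S (fin_index x))) as [|N]; trivial.
    destruct (@fin_index_onto n (S (fin_index x)) y) as [z Hz]; [lia|].
    destruct (H (Some z)). rewrite !fin_index_lt, Hz; lia.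
  - intros E; split; [apply fin_index_lt; lia|].
    intros z. rewrite !fin_index_lt; lia.
Qed.

(** Makes both limit conditions vacuous for finite sequences. *)
Lemma fin_no_limit n (x : upto (fin n)) : ~ is_limit x.
Proof.
  intros [Z H]. destruct (fin_index x) as [|i] eqn:E.
  - apply Z; intros y L. apply fin_index_lt in L; lia.
  - destruct (@fin_index_onto n i x) as [y Hy]; [lia|].
    apply H. exists (Some y). apply fin_index_succ; lia.
Qed.

Lemma sc_reduction_fin n (u : nat -> term C) (d : nat -> nat) s t :
  u 0 ≡ s -> u n ≡ t ->
  (forall i, i < n -> compat_at R (d i) (u i) (u (S i))) ->
  sc_reduction bot R (fin n) s t.
Proof.
  intros Hs Ht Hu.
  refine {| seq_term := fun x : upto (fin n) => u (fin_index x);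
            seq_depth := fun x : fin n => d (proj1_sig x) |}.
  - intros x Z. enough (fin_index x = 0) as -> by assumption.
    destruct (fin_index x) eqn:E; trivial.
    destruct (@fin_index_onto n 0 x) as [y Hy]; [lia|].
    destruct (Z (Some y)). apply fin_index_lt; lia.
  - assumption.
  - intros x y S. apply fin_index_succ in S as ->. simpl.
    apply Hu. destruct x as [i p]; now apply Nat.ltb_lt.
  - intros δ D; now destruct (fin_no_limit D).
  - intros δ D; now destruct (fin_no_limit D).
Qed.

Lemma sc_reduction_finite s t :
  star (compat R) s t -> exists n, inhabited (sc_reduction bot R (fin n) s t).
Proof.
  intros H.
  (* The start is fixed by Leibniz equality, so that a contraction put in front ends exactly in
     [u 0]. *)
  enough (K : exists n (u : nat -> term C) d, u 0 = s /\ u n ≡ t /\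
    forall i, i < n -> compat_at R (d i) (u i) (u (S i))).
  { destruct K as (n & u & d & <- & Ht & Hu). exists n; constructor.
    now apply sc_reduction_fin with u d. }
  induction H as [s t E|s w t H _ (n & u & d & <- & Ht & Hu)].
  - exists 0, (fun _ => s), (fun _ => 0); repeat split; trivial. lia.
  - apply compat_iff_at in H as [m H].
    exists (S n), (fun i => match i with 0 => s | S i => u i end),
      (fun i => match i with 0 => m | S i => d i end).
    repeat split; trivial. intros [|i] L; [assumption|]. apply Hu; lia.
Qed.

Lemma sc_reduction_of_infcl s t :
  infcl (compat R) s t ->
  exists ζ : ordinal, ord_le ζ omega /\ inhabited (sc_reduction bot R ζ s t).
Proof.
  (* Length [ω] needs infinitely many contractions, so terms that reach [t] finitely are given a
     finite length instead. *)
  intros H. destruct (classic (star (compat R) s t)) as [F|N].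
  - destruct (sc_reduction_finite F) as [n r].
    exists (fin n); split; [apply fin_le_omega|assumption].
  - exists omega; split; [|now apply sc_reduction_infinite].
    exists (fun i => i); split; [trivial|]. intros x z _; now exists z.
Qed.

End Sequences.

Unset Implicit Arguments.

Theorem theorem6p4 (C : Type) (bot : C) (R : relation (term C))
    (R_bisim : Proper (bisim ==> bisim ==> iff) R)
    (R_app : appendable (compat R)) (s t : term C) :
  (infcl (compat R) s t <->
     exists ζ : ordinal, inhabited (sc_reduction bot R ζ s t)) /\
  (infcl (compat R) s t ->
     exists ζ : ordinal, ord_le ζ omega /\ inhabited (sc_reduction bot R ζ s t)).
Proof.
  split; [split|].
  - intros H. destruct (sc_reduction_of_infcl bot R_bisim H) as (ζ & _ & r).
    now exists ζ.
  - intros (ζ & [r]). exact (infcl_of_sc_reduction R_app r).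
  - exact (sc_reduction_of_infcl bot R_bisim (s := s) (t := t)).
Qed.
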